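(* Let $A$ be a vector space over $F$ with two bilinear operations $\cdot$ and $[\,,]$ such that $(A,\cdot)$ is a commutative associative algebra and $(A,[\,,])$ is a Lie algebra, and let $D$ be a derivation of $(A,\cdot,[\,,])$. Then $(A,\cdot,[\,,],D)$ is a generalized Poisson algebra as well as a transposed Poisson algebra if and only if the following two identities hold for all $a,b,c\in A$: $$a\cdot [b,c]=a \cdot D(b)\cdot c-a\cdot b\cdot D(c),$$ $$[a\cdot b,c]=D(a)\cdot b\cdot c+a\cdot D(b)\cdot c-a\cdot b\cdot D(c).$$
   Context: The base field $F$ is algebraically closed of characteristic $0$. A derivation of $(A,\cdot,[\,,])$ is a linear map $D:A\to A$ with $D(a\cdot b)=D(a)\cdot b+a\cdot D(b)$ and $D([a,b])=[D(a),b]+[a,D(b)]$ for all $a,b\in A$. Associative algebras are not assumed unital. $(A,\cdot,[\,,],D)$ is a generalized Poisson algebra if $(A,\cdot)$ is a commutative associative algebra, $(A,[\,,])$ is a Lie algebra, $D$ is a derivation of both $(A,\cdot)$ and $(A,[\,,])$, and for all $a,b,c\in A$ $$[a \cdot b, c] = a\cdot [b, c]+[a, c]\cdot b + a\cdot b\cdot D(c).$$ $(A,\cdot,[\,,])$ (or $(A,\cdot,[\,,],D)$) is a transposed Poisson algebra if $(A,\cdot)$ is a commutative associative algebra, $(A,[\,,])$ is a Lie algebra, and for all $a,b,c\in A$ $$2a\cdot [b,c] = [a\cdot b,c] + [b,a\cdot c].$$ *)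

(* Defs.v *)
From HB Require Import structures.
From mathcomp Require Import all_boot all_algebra.

Set Implicit Arguments.
Unset Strict Implicit.
Unset Printing Implicit Defensive.

Import GRing.Theory.
Local Open Scope ring_scope.

(* The vector space A may be infinite-dimensional, and the commutative product
   need not have a unit, so both products are bilinear maps on a bare
   lmodType rather than a ring structure on A. *)

Definition comm_assoc_algebra (F : fieldType) (A : lmodType F)
    (mul : {bilinear A -> A -> A}) : Prop :=
  commutative mul /\ associative mul.

Definition lie_algebra (F : fieldType) (A : lmodType F)
    (br : {bilinear A -> A -> A}) : Prop :=
  (forall a : A, br a a = 0) /\
  (forall a b c : A, br a (br b c) + br b (br c a) + br c (br a b) = 0).

Definition derivation_for (F : fieldType) (A : lmodType F)
    (op : {bilinear A -> A -> A}) (D : {linear A -> A}) : Prop :=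
  forall a b : A, D (op a b) = op (D a) b + op a (D b).

Definition generalized_poisson (F : fieldType) (A : lmodType F)
    (mul br : {bilinear A -> A -> A}) (D : {linear A -> A}) : Prop :=
  [/\ comm_assoc_algebra mul,
      lie_algebra br,
      derivation_for mul D,
      derivation_for br D
    & forall a b c : A,
        br (mul a b) c =
          mul a (br b c) + mul (br a c) b + mul (mul a b) (D c)].

Definition transposed_poisson (F : fieldType) (A : lmodType F)
    (mul br : {bilinear A -> A -> A}) : Prop :=
  [/\ comm_assoc_algebra mul,
      lie_algebra br
    & forall a b c : A,
        mul a (br b c) *+ 2 = br (mul a b) c + br b (mul a c)].

(* Main.v *)
Require Import Defs.
From HB Require Import structures.
From mathcomp Require Import all_boot all_algebra.

Set Implicit Arguments.
Unset Strict Implicit.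
Unset Printing Implicit Defensive.

Import GRing.Theory.
Local Open Scope ring_scope.

(** Write [ab] for [mul a b] and [a'] for [D a].

    Given the two identities, both sides of the generalized Poisson identity,
    and both sides of the transposed one, expand into products of [a], [b],
    [c] with one factor differentiated, and these expansions agree.

    Conversely, expanding both brackets on the right of the transposed Poisson
    identity by the generalized Poisson one, the terms [2a[b,c]] cancel, and
    what remains is [-(b[c,a] + c[a,b]) = ab'c - abc']
    ([generalized_transposed_poisson_bracket]).  The transposed Poisson
    identity also makes the cyclic sum [a[b,c] + b[c,a] + c[a,b]] vanish
    ([transposed_poisson_cyclic]), so the left side is [a[b,c]]: this is the
    first identity.  Substituting it into the generalized Poisson identity,
    for both [a[b,c]] and [b[a,c]], gives the second.  Characteristic zero
    enters only in deducing that the cyclic sum vanishes from the vanishing of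
    its double. *)

Lemma mulr2n_lmod_eq0 (F : fieldType) (A : lmodType F) (x : A) :
  [pchar F] =i pred0 -> x *+ 2 = 0 -> x = 0.
Proof.
move=> /pcharf0P char0 /eqP; rewrite -scaler_nat scaler_eq0 char0 /=.
by move/eqP.
Qed.

Lemma alternating_bilinear_anti (F : fieldType) (A : lmodType F)
    (br : {bilinear A -> A -> A}) (a b : A) :
  (forall x, br x x = 0) -> br a b = - br b a.
Proof.
move=> brxx; apply/eqP; rewrite -addr_eq0; apply/eqP.
by have := brxx (a + b); rewrite linearDl !linearDr !brxx add0r addr0.
Qed.

(** Twice the cyclic sum is a sum of six brackets of the form [[xy,z]], which
    cancel in pairs by commutativity of [mul] and antisymmetry of [br]. *)
Lemma transposed_poisson_cyclic (F : fieldType) (A : lmodType F)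
    (mul br : {bilinear A -> A -> A}) (a b c : A) :
  [pchar F] =i pred0 -> transposed_poisson mul br ->
  mul a (br b c) + mul b (br c a) + mul c (br a b) = 0.
Proof.
move=> char0 [[mulC _] [brxx _] TP]; apply: (mulr2n_lmod_eq0 char0).
have TP' x y z : mul x (br y z) *+ 2 = br (mul x y) z - br (mul z x) y.
  by rewrite TP (alternating_bilinear_anti y _ brxx) (mulC x z).
by rewrite !mulrnDl !TP' [X in X + _]addrC [X in X + _]addrA subrK subrKA subrr.
Qed.

(** The generalized Poisson identity rewrites [[ab,c] - [ac,b]] as [2a[b,c]]
    plus terms free of [[b,c]]; by the transposed one these terms sum to zero. *)
Lemma generalized_transposed_poisson_bracket (F : fieldType) (A : lmodType F)
    (mul br : {bilinear A -> A -> A}) (D : {linear A -> A}) (a b c : A) :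
  generalized_poisson mul br D -> transposed_poisson mul br ->
  - (mul b (br c a) + mul c (br a b)) =
    mul (mul a (D b)) c - mul (mul a b) (D c).
Proof.
move=> [[mulC mulA] [brxx _] _ _ GP] [_ _ TP].
have anti x y := alternating_bilinear_anti x y brxx.
have := TP a b c.
rewrite (anti b (mul a c)) !GP.
rewrite (anti c b) (anti c a) !linearNr /=.
rewrite (mulC b (br a c)) (mulC c (br a b)) -(mulA a c (D b)) (mulC c (D b)).
rewrite mulA.
set p := mul a (br b c); set q := mul (br a c) b; set r := mul (br a b) c.
set s := mul (mul a b) (D c); set t := mul (mul a (D b)) c.
have -> : p + q + s - (- p + r + t) = p *+ 2 + (q - r - (t - s)).
  rewrite !opprD !opprK !addrA.
  by rewrite [LHS](ACl ((1*4)*2*5*6*3)).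
by move/eqP; rewrite -subr_eq0 opprD addrA subrr add0r oppr_eq0 subr_eq0
  => /eqP <-; rewrite opprD opprK.
Qed.

(** Both directions need the right side of the generalized Poisson identity
    computed from the first identity of the theorem. *)
Lemma generalized_poisson_rhs (F : fieldType) (A : lmodType F)
    (mul br : {bilinear A -> A -> A}) (D : {linear A -> A}) (a b c : A) :
  comm_assoc_algebra mul ->
  (forall x y z : A,
      mul x (br y z) = mul (mul x (D y)) z - mul (mul x y) (D z)) ->
  mul a (br b c) + mul (br a c) b + mul (mul a b) (D c) =
  mul (mul (D a) b) c + mul (mul a (D b)) c - mul (mul a b) (D c).
Proof.
move=> [mulC _] id1; rewrite (mulC (br a c)) !id1 (mulC b a) (mulC b (D a)).
by rewrite -addrA subrK addrAC [X in X - _]addrC.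
Qed.

Theorem theorem2p1 (F : closedFieldType) (char0 : [pchar F] =i pred0)
    (A : lmodType F) (mul br : {bilinear A -> A -> A}) (D : {linear A -> A})
    (Hmul : comm_assoc_algebra mul) (Hbr : lie_algebra br)
    (HDmul : derivation_for mul D) (HDbr : derivation_for br D) :
  (generalized_poisson mul br D /\ transposed_poisson mul br) <->
  ((forall a b c : A,
      mul a (br b c) = mul (mul a (D b)) c - mul (mul a b) (D c)) /\
   (forall a b c : A,
      br (mul a b) c =
        mul (mul (D a) b) c + mul (mul a (D b)) c - mul (mul a b) (D c))).
Proof.
have [mulC mulA] := Hmul; have [brxx _] := Hbr.
have anti x y := alternating_bilinear_anti x y brxx.
split=> [[GP TP] | [id1 id2]].
- have first a b c :
      mul a (br b c) = mul (mul a (D b)) c - mul (mul a b) (D c).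
    have := generalized_transposed_poisson_bracket a b c GP TP.
    move=> <-; have := transposed_poisson_cyclic a b c char0 TP.
    by move/eqP; rewrite -addrA addr_eq0 => /eqP.
  split=> // a b c; have [_ _ _ _ ->] := GP.
  exact: generalized_poisson_rhs.
- split; split=> // a b c.
    by rewrite id2 (generalized_poisson_rhs a b c Hmul id1).
  rewrite id1 (anti b (mul a c)) !id2.
  (* Normalise the products in [[ac,b]] to the order [a], [b], [c]. *)
  rewrite -(mulA (D a) c b) (mulC c b) (mulA (D a) b c).
  rewrite -(mulA a (D c) b) (mulC (D c) b) (mulA a b).
  rewrite -(mulA a c (D b)) (mulC c (D b)) (mulA a (D b)).
  rewrite -[X in _ = X - _]addrA -[X in _ = _ - X]addrA opprD addrACA.
  by rewrite subrr add0r opprB mulr2n.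
Qed.
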